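(* Let $n\ge 1$ and let $k=\left[\frac{1}{2}(n-1)\right]$. Every positive permutation braid $\beta\in B_n$ which has $\frac{1}{2}n(n-1)-\left[\frac{1}{2}(n-1)\right]$ crossings and whose closure is a knot is conjugate in $B_n$ to $\Delta_n\sigma_1^{-1}\sigma_2^{-1}\cdots\sigma_k^{-1}$.
   Context: $[x]$ denotes the integer part of $x$. $B_n$ is Artin's braid group on $n$ strings, with generators $\sigma_1,\dots,\sigma_{n-1}$ and relations $\sigma_i\sigma_j=\sigma_j\sigma_i$ for $|i-j|\ge 2$ and $\sigma_i\sigma_{i+1}\sigma_i=\sigma_{i+1}\sigma_i\sigma_{i+1}$ for $1\le i\le n-2$. A positive braid is an element of $B_n$ which can be written as a word in positive powers of the generators $\sigma_i$, without inverses. A positive permutation braid is a positive braid in which no pair of strings crosses more than once. The number of crossings of a positive braid is the length of any positive word in the $\sigma_i$ representing it. $\Delta_n$ is Garside's fundamental half-twist braid, i.e. the positive permutation braid in $B_n$ in which every pair of strings crosses exactly once (so it has $\frac12 n(n-1)$ crossings and its permutation is $j\mapsto n+1-j$). The closure of a braid is the link in $S^3$ obtained by identifying the initial points of the strings with the corresponding end points; it is a knot when it has exactly one component. An empty product is the identity. *)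

(* Defs.v *)
(* The axioms of boolp are used only to turn the word congruence braid_eq into a
   boolean relation, from which the braid group is built as a quotient. *)
From Stdlib Require Import Relations.
From HB Require Import structures.
From mathcomp Require Import all_boot all_order all_algebra all_fingroup.
From mathcomp Require Import boolp zify.

Set Implicit Arguments.
Unset Strict Implicit.
Unset Printing Implicit Defensive.

Import GroupScope.
Local Open Scope quotient_scope.

Section BraidGroup.
Variable n : nat.

(* Indices start at 0: k : 'I_n.-1 stands for sigma_(k+1), and (k, true) for
   its inverse. *)
Definition letter := ('I_n.-1 * bool)%type.
Definition word := seq letter.

Inductive braid_step : word -> word -> Prop :=
| StepCancel u v k b :
    braid_step (u ++ [:: (k, b); (k, ~~ b)] ++ v) (u ++ v)
| StepComm u v (i j : 'I_n.-1) : i.+1 < j ->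
    braid_step (u ++ [:: (i, false); (j, false)] ++ v)
               (u ++ [:: (j, false); (i, false)] ++ v)
| StepBraid u v (i j : 'I_n.-1) : j = i.+1 :> nat ->
    braid_step (u ++ [:: (i, false); (j, false); (i, false)] ++ v)
               (u ++ [:: (j, false); (i, false); (j, false)] ++ v).

Definition braid_eq : word -> word -> Prop := clos_refl_sym_trans _ braid_step.

Definition braid_eqb : rel word := fun u v => `[< braid_eq u v >].

Lemma braid_eqb_refl : reflexive braid_eqb.
Proof. by move=> u; apply/asboolP; exact: rst_refl. Qed.

Lemma braid_eqb_sym : symmetric braid_eqb.
Proof. by move=> u v; apply/asboolP/asboolP => h; exact: rst_sym. Qed.

Lemma braid_eqb_trans : transitive braid_eqb.
Proof.
move=> v u w /asboolP h1 /asboolP h2; apply/asboolP.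
exact: rst_trans h1 h2.
Qed.

Canonical braid_eqb_equiv :=
  EquivRel braid_eqb braid_eqb_refl braid_eqb_sym braid_eqb_trans.

Definition braid := {eq_quot braid_eqb}.
HB.instance Definition _ := Choice.on braid.
HB.instance Definition _ := EqQuotient.on braid.

Definition braid_of_word (w : word) : braid := \pi_braid w.

Definition word_of_braid (x : braid) : word := generic_quotient.repr x.

Lemma braid_of_wordP u v : braid_of_word u = braid_of_word v <-> braid_eq u v.
Proof.
by split=> [/eqmodP/asboolP //|h]; apply/eqmodP/asboolP.
Qed.

Lemma braid_eq_cat u u' v v' :
  braid_eq u u' -> braid_eq v v' -> braid_eq (u ++ v) (u' ++ v').
Proof.
move=> hu hv; apply: (@rst_trans _ _ _ (u' ++ v)).
  elim: hu => [x y []|x|x y _|x y z _ h1 _ h2].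
  - by move=> a b k c; rewrite -!catA; apply: rst_step; exact: StepCancel.
  - move=> a b i j h; rewrite -!catA; apply: rst_step.
    exact: (StepComm _ (b ++ v) h).
  - move=> a b i j h; rewrite -!catA; apply: rst_step.
    exact: (StepBraid _ (b ++ v) h).
  - exact: rst_refl.
  - exact: rst_sym.
  - exact: rst_trans h1 h2.
elim: hv => [x y []|x|x y _|x y z _ h1 _ h2].
- move=> a b k c; rewrite !(catA u'); apply: rst_step; exact: StepCancel.
- move=> a b i j h; rewrite !(catA u'); apply: rst_step; exact: StepComm.
- move=> a b i j h; rewrite !(catA u'); apply: rst_step; exact: StepBraid.
- exact: rst_refl.
- exact: rst_sym.
- exact: rst_trans h1 h2.
Qed.

Definition word_inv (w : word) : word := rev [seq (l.1, ~~ l.2) | l <- w].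

Lemma word_inv_cons l w : word_inv (l :: w) = word_inv w ++ [:: (l.1, ~~ l.2)].
Proof. by rewrite /word_inv /= rev_cons cats1. Qed.

Lemma word_invK : involutive word_inv.
Proof.
move=> w; rewrite /word_inv map_rev revK -map_comp -[RHS]map_id.
by apply: eq_map => -[k b] /=; rewrite negbK.
Qed.

Lemma word_mulV w : braid_eq (w ++ word_inv w) [::].
Proof.
elim: w => [|[k b] w ih]; first exact: rst_refl.
rewrite word_inv_cons /= -cat1s catA -[_ :: _]cat1s.
apply: (@rst_trans _ _ _ ([:: (k, b)] ++ [::] ++ [:: (k, ~~ b)])).
  rewrite -catA; apply: braid_eq_cat; first exact: rst_refl.
  rewrite catA; apply: braid_eq_cat; [exact: ih | exact: rst_refl].
by apply: rst_step; exact: (StepCancel [::] [::] k b).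
Qed.

Lemma word_mulVw w : braid_eq (word_inv w ++ w) [::].
Proof. by rewrite -{2}[w]word_invK; exact: word_mulV. Qed.

Definition braid_mul (x y : braid) : braid :=
  braid_of_word (word_of_braid x ++ word_of_braid y).
Definition braid_inv (x : braid) : braid := braid_of_word (word_inv (word_of_braid x)).
Definition braid_one : braid := braid_of_word [::].

Lemma repr_braid_of_word u : braid_eq (word_of_braid (braid_of_word u)) u.
Proof. by apply/braid_of_wordP; exact: reprK. Qed.

Lemma braid_mulE u v :
  braid_mul (braid_of_word u) (braid_of_word v) = braid_of_word (u ++ v).
Proof.
by apply/braid_of_wordP; apply: braid_eq_cat; exact: repr_braid_of_word.
Qed.

Lemma braid_of_wordK (x : braid) : braid_of_word (word_of_braid x) = x.
Proof. exact: reprK. Qed.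

Lemma braid_mulA : associative braid_mul.
Proof.
move=> x y z; rewrite -[x]braid_of_wordK -[y]braid_of_wordK.
by rewrite -[z]braid_of_wordK !braid_mulE catA.
Qed.

Lemma braid_mul1 : left_id braid_one braid_mul.
Proof. by move=> x; rewrite -[x]braid_of_wordK braid_mulE. Qed.

Lemma braid_mulr1 : right_id braid_one braid_mul.
Proof. by move=> x; rewrite -[x]braid_of_wordK braid_mulE cats0. Qed.

Lemma braid_mulV : left_inverse braid_one braid_inv braid_mul.
Proof.
move=> x; rewrite -{2}[x]braid_of_wordK braid_mulE.
exact/braid_of_wordP/word_mulVw.
Qed.

Lemma braid_mulrV : right_inverse braid_one braid_inv braid_mul.
Proof.
move=> x; rewrite -{1}[x]braid_of_wordK braid_mulE.
exact/braid_of_wordP/word_mulV.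
Qed.

HB.instance Definition _ := isGroup.Build braid
  braid_mulA braid_mul1 braid_mulr1 braid_mulV braid_mulrV.

Definition sigma (k : 'I_n.-1) : braid := braid_of_word [:: (k, false)].

Lemma braid_of_word_cat u v :
  braid_of_word (u ++ v) = braid_of_word u * braid_of_word v.
Proof. by rewrite -braid_mulE. Qed.

Lemma sigmaV k : (sigma k)^-1 = braid_of_word [:: (k, true)].
Proof.
apply: (mulgI (sigma k)); rewrite mulgV -braid_of_word_cat.
apply/esym/(braid_of_wordP _ [::]); apply: rst_step.
exact: (StepCancel [::] [::] k false).
Qed.

Lemma sigma_comm (i j : 'I_n.-1) :
  i.+1 < j -> sigma i * sigma j = sigma j * sigma i.
Proof.
move=> h; rewrite -!braid_of_word_cat; apply/braid_of_wordP.
by apply: rst_step; exact: (StepComm [::] [::] h).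
Qed.

Lemma sigma_braid (i j : 'I_n.-1) : j = i.+1 :> nat ->
  sigma i * sigma j * sigma i = sigma j * sigma i * sigma j.
Proof.
move=> h; rewrite /sigma -!braid_of_word_cat; apply/braid_of_wordP.
by apply: rst_step; exact: (StepBraid [::] [::] h).
Qed.

Section Lift.
Variables (G : groupType) (f : 'I_n.-1 -> G).
Hypothesis f_comm : forall i j : 'I_n.-1, i.+1 < j -> f i * f j = f j * f i.
Hypothesis f_braid : forall i j : 'I_n.-1, j = i.+1 :> nat ->
  f i * f j * f i = f j * f i * f j.

Definition word_eval (w : word) : G :=
  \prod_(l <- w) (if l.2 then (f l.1)^-1 else f l.1).

Lemma word_eval_cat u v : word_eval (u ++ v) = word_eval u * word_eval v.
Proof. exact: big_cat. Qed.

Lemma word_eval_braid_eq u v : braid_eq u v -> word_eval u = word_eval v.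
Proof.
elim=> [x y []|//|x y _ ->//|x y z _ -> _ -> //] {}u {}v.
- move=> k b; rewrite !word_eval_cat; congr (_ * _).
  rewrite /word_eval !big_cons big_nil /= mulg1.
  by case: b => /=; rewrite ?mulgV ?mulVg mul1g.
- move=> i j h; rewrite !word_eval_cat; congr (_ * (_ * _)).
  by rewrite /word_eval !big_cons big_nil /= !mulg1 f_comm.
- move=> i j h; rewrite !word_eval_cat; congr (_ * (_ * _)).
  by rewrite /word_eval !big_cons big_nil /= !mulg1 !mulgA f_braid.
Qed.

Lemma word_eval_repr w : word_eval (word_of_braid (braid_of_word w)) = word_eval w.
Proof. exact/word_eval_braid_eq/repr_braid_of_word. Qed.

End Lift.

Lemma lower_subproof (k : 'I_n.-1) : k < n. Proof. by case: k => /= k; lia. Qed.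
Lemma upper_subproof (k : 'I_n.-1) : k.+1 < n.
Proof. by case: k => /= k; lia. Qed.

(* The positions whose strings cross in the letter k. *)
Definition lower (k : 'I_n.-1) : 'I_n := Ordinal (lower_subproof k).
Definition upper (k : 'I_n.-1) : 'I_n := Ordinal (upper_subproof k).

Definition swap (k : 'I_n.-1) : {perm 'I_n} := tperm (lower k) (upper k).

Lemma swapP (k : 'I_n.-1) (p : 'I_n) :
  (p = k :> nat /\ swap k p = k.+1 :> nat) \/
  (p = k.+1 :> nat /\ swap k p = k :> nat) \/
  (p <> k :> nat /\ p <> k.+1 :> nat /\ swap k p = p :> nat).
Proof.
rewrite /swap; case: tpermP => [->|->|h1 h2] /=; first by left.
  by right; left.
right; right; split=> [h|]; first by apply: h1; apply: val_inj.
by split=> // h; apply: h2; apply: val_inj.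
Qed.

Lemma swap_comm (i j : 'I_n.-1) :
  i.+1 < j -> swap i * swap j = swap j * swap i.
Proof.
move=> h; apply/permP => p; rewrite !permM; apply: val_inj => /=.
have := swapP i p; have := swapP j (swap i p).
have := swapP j p; have := swapP i (swap j p); lia.
Qed.

Lemma swap_braid (i j : 'I_n.-1) : j = i.+1 :> nat ->
  swap i * swap j * swap i = swap j * swap i * swap j.
Proof.
move=> h; apply/permP => p; rewrite !permM; apply: val_inj => /=.
have := swapP i p; have := swapP j (swap i p).
have := swapP i (swap j (swap i p)).
have := swapP j p; have := swapP i (swap j p).
have := swapP j (swap i (swap j p)); lia.
Qed.

(* The string of b starting at position i ends at position string_end b i.
   Braids are read from left to right, as are products in {perm 'I_n}. *)
Definition string_end (b : braid) : {perm 'I_n} := word_eval swap (word_of_braid b).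

Lemma string_end_word w : string_end (braid_of_word w) = word_eval swap w.
Proof. exact: (word_eval_repr swap_comm swap_braid). Qed.

Lemma string_endM : {morph string_end : x y / x * y}.
Proof.
move=> x y; rewrite -[x]braid_of_wordK -[y]braid_of_wordK -braid_of_word_cat.
by rewrite !string_end_word word_eval_cat.
Qed.

Lemma string_end_sigma k : string_end (sigma k) = swap k.
Proof. by rewrite string_end_word /word_eval big_seq1. Qed.

(* Closing b glues the end of the string i to the start of the string j exactly
   when j = string_end b i; the components of the closure are the classes of
   strings under this gluing. *)
Definition glued (b : braid) : rel 'I_n :=
  fun i j => (j == string_end b i) || (i == string_end b j).

Definition closure_components (b : braid) : nat := n_comp (glued b) 'I_n.

Definition closure_is_knot (b : braid) : Prop := closure_components b = 1%N.

Definition positive_word (w : seq 'I_n.-1) : braid := \prod_(k <- w) sigma k.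

(* crossings w i j is the number of times that the strings starting at the
   positions i and j cross in the positive word w. *)
Fixpoint crossings (w : seq 'I_n.-1) (i j : 'I_n) : nat :=
  if w is k :: w' then
    ([set i; j] == [set lower k; upper k]) + crossings w' (swap k i) (swap k j)
  else 0.

Definition positive_permutation_braid (b : braid) : Prop :=
  exists2 w : seq 'I_n.-1, b = positive_word w &
    forall i j : 'I_n, i != j -> crossings w i j <= 1.

Definition has_crossing_number (b : braid) (m : nat) : Prop :=
  exists2 w : seq 'I_n.-1, b = positive_word w & size w = m.

Definition half_twist (b : braid) : Prop :=
  exists2 w : seq 'I_n.-1, b = positive_word w &
    forall i j : 'I_n, i != j -> crossings w i j = 1%N.

Definition braid_conjugate (x y : braid) : Prop := exists g : braid, y = x ^ g.

Lemma positive_wordE w :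
  positive_word w = braid_of_word [seq (k, false) | k <- w].
Proof.
rewrite /positive_word; elim: w => [|k w ih]; first by rewrite big_nil.
by rewrite big_cons ih -braid_of_word_cat.
Qed.

Lemma positive_word_eq u v : positive_word u = positive_word v ->
  braid_eq [seq (k, false) | k <- u] [seq (k, false) | k <- v].
Proof. by rewrite !positive_wordE => /braid_of_wordP. Qed.

(* The existential choices of a positive word in the definitions above are
   immaterial: its length and its pairwise crossings depend only on the braid. *)
Section Invariance.
Local Open Scope ring_scope.

Definition letter_sign (b : bool) : int := if b then -1 else 1.

Definition exponent_sum (w : word) : int := \sum_(l <- w) letter_sign l.2.

Lemma exponent_sum_braid_eq u v :
  braid_eq u v -> exponent_sum u = exponent_sum v.
Proof.
rewrite /exponent_sum.
elim=> [x y []|//|x y _ ->//|x y z _ -> _ -> //] {}u {}v.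
- by move=> k b; rewrite !big_cat !big_cons big_nil /=; case: b => /=; lia.
- by move=> i j h; rewrite !big_cat !big_cons big_nil.
- by move=> i j h; rewrite !big_cat !big_cons big_nil.
Qed.

Lemma size_positive_word u v :
  positive_word u = positive_word v -> size u = size v.
Proof.
move=> /positive_word_eq/exponent_sum_braid_eq.
have E w : exponent_sum [seq (k, false) | k <- w] = (size w)%:Z.
  elim: w => [|k w ih]; rewrite /exponent_sum ?big_nil // big_cons.
  by move: ih; rewrite /exponent_sum /= => ->; lia.
by rewrite !E => -[].
Qed.

Lemma has_crossing_number_uniq b p q :
  has_crossing_number b p -> has_crossing_number b q -> p = q.
Proof.
by move=> [u -> <-] [v e <-]; apply: size_positive_word.
Qed.

Fixpoint signed_crossings (w : word) (i j : 'I_n) : int :=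
  if w is (k, b) :: w' then
    letter_sign b * ([set i; j] == [set lower k; upper k])%:Z +
    signed_crossings w' (swap k i) (swap k j)
  else 0.

Lemma crossE (k : 'I_n.-1) (i j : 'I_n) :
  ([set i; j] == [set lower k; upper k]) =
  (((i == k :> nat) && (j == k.+1 :> nat)) ||
   ((j == k :> nat) && (i == k.+1 :> nat)))%N.
Proof.
apply/eqP/idP => [/setP e|].
  move: (e i) (e j) (e (lower k)) (e (upper k)).
  rewrite !inE !eqxx /= ?orbT -!val_eqE /=; lia.
case/orP => /andP [/eqP a /eqP b].
  by congr [set _; _]; apply: val_inj.
by rewrite setUC; congr [set _; _]; apply: val_inj.
Qed.

Lemma swapV k (b : bool) : (if b then (swap k)^-1 else swap k)%g = swap k.
Proof. by case: b; rewrite // tpermV. Qed.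

Lemma signed_crossings_cat u v i j :
  signed_crossings (u ++ v) i j =
  signed_crossings u i j +
  signed_crossings v (word_eval swap u i) (word_eval swap u j).
Proof.
elim: u i j => [|[k b] u ih] i j /=.
  by rewrite /word_eval big_nil !perm1 GRing.add0r.
by rewrite ih GRing.addrA /word_eval big_cons swapV !permM.
Qed.

Lemma signed_crossings_positive w i j :
  signed_crossings [seq (k, false) | k <- w] i j = (crossings w i j)%:Z.
Proof.
elim: w i j => [//|k w ih] i j.
by rewrite [LHS]/= ih GRing.mul1r -PoszD.
Qed.

Lemma cross_perm (s : {perm 'I_n}) (a b p q : 'I_n) :
  ([set s p; s q] == [set s a; s b]) = ([set p; q] == [set a; b]).
Proof. by rewrite -!imset_set1 -!imsetU (inj_eq (imset_inj perm_inj)). Qed.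

Lemma swap_lower k : swap k (lower k) = upper k.
Proof. exact: tpermL. Qed.

Lemma swap_upper k : swap k (upper k) = lower k.
Proof. exact: tpermR. Qed.

Lemma swap_id (k : 'I_n.-1) (p : 'I_n) :
  p != k :> nat -> p != k.+1 :> nat -> swap k p = p.
Proof. by move=> h1 h2; apply: tpermD; rewrite -val_eqE eq_sym. Qed.

Lemma crossings_comm (k l : 'I_n.-1) p q : (k.+1 < l)%N ->
  crossings [:: k; l] p q = crossings [:: l; k] p q.
Proof.
move=> h.
have el : swap k (lower l) = lower l by apply: swap_id => /=; lia.
have eu : swap k (upper l) = upper l by apply: swap_id => /=; lia.
have fl : swap l (lower k) = lower k by apply: swap_id => /=; lia.
have fu : swap l (upper k) = upper k by apply: swap_id => /=; lia.
by rewrite /= !addn0 addnC -{1}el -{1}eu -{2}fl -{2}fu !cross_perm.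
Qed.

Lemma crossings_braid (k l : 'I_n.-1) p q : l = k.+1 :> nat ->
  crossings [:: k; l; k] p q = crossings [:: l; k; l] p q.
Proof.
move=> h; have e : lower l = upper k by exact: val_inj.
have ek : swap k (upper l) = upper l by apply: swap_id => /=; lia.
have el : swap l (lower k) = lower k by apply: swap_id => /=; lia.
have elk : swap l (upper k) = upper l by rewrite -e swap_lower.
have elu : swap l (upper l) = upper k by rewrite swap_upper.
have c1 x y : ([set swap k x; swap k y] == [set upper k; upper l]) =
    ([set x; y] == [set lower k; upper l]).
  by rewrite -{1}(swap_lower k) -{1}ek cross_perm.
have c2 x y : ([set swap k x; swap k y] == [set lower k; upper l]) =
    ([set x; y] == [set upper k; upper l]).
  by rewrite -{1}(swap_upper k) -{1}ek cross_perm.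
have c3 x y : ([set swap l x; swap l y] == [set lower k; upper k]) =
    ([set x; y] == [set lower k; upper l]).
  by rewrite -{1}el -{1}elu cross_perm.
have c4 x y : ([set swap l x; swap l y] == [set lower k; upper l]) =
    ([set x; y] == [set lower k; upper k]).
  by rewrite -{1}el -{1}elk cross_perm.
by rewrite /= e !c1 !c3 !c2 !c4 !addn0 [RHS]addnC [X in _ = addn X _]addnC -addnA.
Qed.

Lemma signed_crossings_braid_eq u v i j :
  braid_eq u v -> signed_crossings u i j = signed_crossings v i j.
Proof.
elim=> [x y []|//|x y _ ->//|x y z _ -> _ -> //] {}u {}v.
- move=> k b; rewrite !signed_crossings_cat.
  set p := word_eval swap u i; set q := word_eval swap u j; congr (_ + _).
  rewrite /= /letter_sign /word_eval !big_cons big_nil !swapV mulg1 !permM !tpermK.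
  rewrite GRing.addrA -[RHS]GRing.add0r; congr (_ + _); rewrite !crossE.
  by have := swapP k p; have := swapP k q; case: b => /=; lia.
- move=> k l h; rewrite !signed_crossings_cat.
  congr (_ + (_ + signed_crossings v (fun_of_perm _ _) (fun_of_perm _ _))).
  + exact: etrans (signed_crossings_positive [:: k; l] _ _)
      (etrans (congr1 Posz (crossings_comm _ _ h))
        (esym (signed_crossings_positive [:: l; k] _ _))).
  + by rewrite /word_eval !big_cons !big_nil !mulg1 (swap_comm h).
  + by rewrite /word_eval !big_cons !big_nil !mulg1 (swap_comm h).
- move=> k l h; rewrite !signed_crossings_cat.
  congr (_ + (_ + signed_crossings v (fun_of_perm _ _) (fun_of_perm _ _))).
  + exact: etrans (signed_crossings_positive [:: k; l; k] _ _)
      (etrans (congr1 Posz (crossings_braid _ _ h))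
        (esym (signed_crossings_positive [:: l; k; l] _ _))).
  + by rewrite /word_eval !big_cons !big_nil !mulg1 !mulgA (swap_braid h).
  + by rewrite /word_eval !big_cons !big_nil !mulg1 !mulgA (swap_braid h).
Qed.

Lemma crossings_positive_word u v i j :
  positive_word u = positive_word v -> crossings u i j = crossings v i j.
Proof.
move=> /positive_word_eq/signed_crossings_braid_eq => /(_ i j).
by rewrite !signed_crossings_positive => -[].
Qed.

End Invariance.

Section HalfTwistExists.

Local Ltac bool_lia :=
  repeat (match goal with
          | |- context [@eq_op _ ?a ?b] => case: (a =P b) => ?
          | |- context [leq ?a ?b] => case: (leqP a b) => ?
          end; rewrite //=; try (exfalso; lia)).

Let endp (w : seq 'I_n.-1) (p : 'I_n) : 'I_n := foldl (fun p k => swap k p) p w.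

Lemma crossings_cat u v i j :
  crossings (u ++ v) i j = crossings u i j + crossings v (endp u i) (endp u j).
Proof. by elim: u i j => [//|k u ih] i j /=; rewrite ih addnA. Qed.

Let run s l : seq 'I_n.-1 := pmap insub (iota s l).

Lemma run_endp s l (p : 'I_n) : s + l < n ->
  (p = s :> nat /\ endp (run s l) p = s + l :> nat) \/
  (s < p <= s + l /\ endp (run s l) p = p.-1 :> nat) \/
  (~~ (s <= p <= s + l) /\ endp (run s l) p = p :> nat).
Proof.
elim: l s p => [|l ih] s p h; rewrite /run /endp /=; first by lia.
have hs : s < n.-1 by lia.
rewrite insubT /=.
have := ih s.+1 (swap (Sub s hs) p) ltac:(lia).
have := swapP (Sub s hs) p; rewrite /run /endp /=; lia.
Qed.

Lemma run_crossings s l (p q : 'I_n) : s + l < n -> p != q ->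
  crossings (run s l) p q =
  (((p == s :> nat) && (s < q <= s + l)) ||
   ((q == s :> nat) && (s < p <= s + l))).
Proof.
elim: l s p q => [|l ih] s p q h pq; rewrite /run /=; first by lia.
have hs : s < n.-1 by lia.
rewrite insubT /=.
have e := ih s.+1 (swap (Sub s hs) p) (swap (Sub s hs) q) ltac:(lia).
rewrite -/(run s.+1 l) e ?(inj_eq perm_inj) // crossE {e ih}.
move: pq; rewrite -val_eqE /= => /eqP pq.
case: (swapP (Sub s hs) p) => [[/= hp ->]|[[/= hp ->]|[/= hp [hp' ->]]]];
case: (swapP (Sub s hs) q) => [[/= hq ->]|[[/= hq ->]|[/= hq [hq' ->]]]];
  bool_lia.
Qed.

Lemma crossings_above m w (p q : 'I_n) :
  all (fun k : 'I_n.-1 => k.+1 < m) w -> m <= p -> crossings w p q = 0.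
Proof.
elim: w p q => [//|k w ih] p q /= /andP [hk hw] hp.
have := swapP k p => hs; rewrite ih //; last by lia.
by rewrite crossE; have := ltn_ord p; lia.
Qed.

Lemma crossingsC w i j : crossings w i j = crossings w j i.
Proof. by elim: w i j => [//|k w ih] i j /=; rewrite ih setUC. Qed.

Lemma half_twist_exists : exists b, half_twist b.
Proof.
suff [w _ hw] : exists2 w : seq 'I_n.-1, all (fun k : 'I_n.-1 => k.+1 < n) w &
    forall i j : 'I_n, i < n -> j < n -> i != j -> crossings w i j = 1%N.
  by exists (positive_word w), w => // i j; apply: hw.
suff: forall m, m <= n ->
  exists2 w : seq 'I_n.-1, all (fun k : 'I_n.-1 => k.+1 < m) w &
    forall i j : 'I_n, i < m -> j < m -> i != j -> crossings w i j = 1%N.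
  exact.
elim=> [_|m ih hm]; first by exists [::].
have [|w hw1 hw2] := ih; first by lia.
exists (run 0 m ++ w).
  rewrite all_cat; apply/andP; split.
    apply/allP => k; rewrite mem_pmap => /mapP [x].
    by rewrite mem_iota; case: insubP => // u _ <- hx [->]; move: hx => /=; lia.
  by apply: sub_all hw1 => k; lia.
move=> i j hi hj ij; rewrite crossings_cat run_crossings //.
have ei := @run_endp 0 m i hm; have ej := @run_endp 0 m j hm.
have ij' := ij; move: ij'; rewrite -val_eqE /= => ij'.
have [i0|i0] := eqVneq (i : nat) 0.
  by rewrite (crossings_above _ hw1); lia.
have [j0|j0] := eqVneq (j : nat) 0.
  by rewrite crossingsC (crossings_above _ hw1); lia.
by rewrite hw2 -?val_eqE /=; lia.
Qed.

End HalfTwistExists.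

End BraidGroup.

(* Main.v *)
(* Write Delta = beta * gamma with gamma a positive word in k = [(n-1)/2]
   letters.  The reversal permutation preserves the sets {p < i+1 or p >= n-1-i},
   i < k, so for the closure of beta to be connected gamma must contain, for each
   i < k, the letter i or its mirror image n-2-i; having only k letters, it
   contains exactly one of them, once.  Since conjugation by Delta mirrors the
   generators, Delta (xy)^-1 is conjugate to Delta (y x^Delta)^-1: first letters
   of gamma can be moved to the end and mirrored.  Letters of classes at distance
   at least 2, or on opposite sides, commute, and this suffices to sort gamma
   into sigma_k ... sigma_1, one class at a time.

   The half-twist facts rest on the exchange property: a reduced positive word
   whose permutation has a descent at l equals, as a braid, a word starting with
   l. *)
Require Import Defs.
From mathcomp Require Import all_boot all_fingroup.
From mathcomp Require Import zify.

Set Implicit Arguments.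
Unset Strict Implicit.
Unset Printing Implicit Defensive.

Import GroupScope.

Section PositivePermutationBraids.
Variable n : nat.
Implicit Types (k l : 'I_n.-1) (i j : 'I_n) (u v w : seq 'I_n.-1).

(** * Permutations and crossings of positive words *)

Definition word_perm w : {perm 'I_n} := string_end (positive_word w).

Lemma positive_word_cons k w :
  positive_word (k :: w) = sigma k * positive_word w.
Proof. by rewrite /positive_word big_cons. Qed.

Lemma positive_word_cat u v :
  positive_word (u ++ v) = positive_word u * positive_word v.
Proof. by rewrite /positive_word big_cat. Qed.

Lemma positive_word_rcons k w :
  positive_word (rcons w k) = positive_word w * sigma k.
Proof. by rewrite -cats1 positive_word_cat /positive_word big_seq1. Qed.

Lemma word_perm_nil : word_perm [::] = 1.
Proof. by rewrite /word_perm positive_wordE string_end_word /word_eval big_nil. Qed.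

Lemma word_perm_cons k w : word_perm (k :: w) = swap k * word_perm w.
Proof. by rewrite /word_perm positive_word_cons string_endM string_end_sigma. Qed.

Lemma word_perm_cat u v : word_perm (u ++ v) = word_perm u * word_perm v.
Proof. by rewrite /word_perm positive_word_cat string_endM. Qed.

Lemma crossings_word_cat u v i j :
  crossings (u ++ v) i j =
  (crossings u i j + crossings v (word_perm u i) (word_perm u j))%N.
Proof.
elim: u i j => [|k u ih] i j /=; first by rewrite word_perm_nil !perm1.
by rewrite ih word_perm_cons !permM addnA.
Qed.

(** Each crossing of two strings reverses their order. *)
Lemma odd_crossings w i j : i != j ->
  odd (crossings w i j) = (i < j) (+) (word_perm w i < word_perm w j).
Proof.
elim: w i j => [|k w ih] i j ij.
  by rewrite word_perm_nil !perm1 addbb.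
rewrite /= oddD ih ?(inj_eq perm_inj) // word_perm_cons !permM addbA.
congr (_ (+) _); move: ij; rewrite -val_eqE crossE /= oddb.
by have := swapP k i; have := swapP k j; lia.
Qed.

(** * Reduced words and the exchange property *)

Definition reduced w := forall i j, i != j -> crossings w i j <= 1.

Lemma crossings_reduced w i j : reduced w -> i != j ->
  crossings w i j = (i < j) (+) (word_perm w i < word_perm w j).
Proof.
move=> r ij; rewrite -odd_crossings //.
by case: (crossings w i j) (r i j ij) => [|[]].
Qed.

Lemma reduced_eq u v :
  positive_word u = positive_word v -> reduced u -> reduced v.
Proof. by move=> e r i j ij; rewrite -(crossings_positive_word _ _ e) r. Qed.

Lemma lower_neq_upper k : lower k != upper k.
Proof. by rewrite -val_eqE /=; lia. Qed.

(** The two strings crossed by [k] cannot cross again in [w], so [w] preserves their order. *)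
Lemma reduced_cons k w : reduced (k :: w) ->
  reduced w /\ word_perm w (lower k) < word_perm w (upper k).
Proof.
move=> r.
have rw : reduced w.
  move=> i j ij; have := r (swap k i) (swap k j).
  by rewrite (inj_eq perm_inj) => /(_ ij) /=; rewrite !tpermK; lia.
split=> //.
have := r _ _ (lower_neq_upper k); rewrite /= eqxx swap_lower swap_upper.
rewrite crossings_reduced // 1?eq_sym ?lower_neq_upper //=.
have : word_perm w (lower k) != word_perm w (upper k).
  by rewrite (inj_eq perm_inj) lower_neq_upper.
by rewrite -val_eqE /=; lia.
Qed.

Definition descent w l := word_perm w (upper l) < word_perm w (lower l).

Lemma descent_cons k w : reduced (k :: w) -> descent (k :: w) k.
Proof.
case/reduced_cons=> _.
by rewrite /descent word_perm_cons !permM swap_upper swap_lower.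
Qed.

Lemma commute_far k l : (k.+1 < l) || (l.+1 < k) ->
  commute (sigma k) (sigma l).
Proof. by case/orP=> h; rewrite /commute (sigma_comm h). Qed.

(** Strong induction on the length: for adjacent [k] and [l] the hypothesis is used twice, the
    second time on the word left by the first use. *)
Lemma exchange w l : reduced w -> descent w l ->
  exists w', positive_word w = positive_word (l :: w').
Proof.
have [s] := ubnP (size w); elim: s w l => // s ih [|k w] l /= hs r d.
  by move: d; rewrite /descent word_perm_nil !perm1 /=; lia.
have [->|nkl] := eqVneq k l; first by exists w.
move: nkl; rewrite -val_eqE /= => nkl.
have [rw dk] := reduced_cons r.
have [far|near] := boolP ((k.+1 < l) || (l.+1 < k)).
  have dl : descent w l.
    move: d; rewrite /descent word_perm_cons !permM.
    by rewrite !swap_id //=; lia.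
  have [w' e] := ih w l hs rw dl; exists (k :: w').
  by rewrite !positive_word_cons e positive_word_cons !mulgA commute_far.
have braid_kl : sigma k * sigma l * sigma k = sigma l * sigma k * sigma l.
  have [h|h] : l = k.+1 :> nat \/ k = l.+1 :> nat by lia.
    exact: sigma_braid.
  by rewrite (sigma_braid h).
(* Here the permutation of k :: w reverses three consecutive positions, so two
   exchanges in w expose the longer side of the braid relation. *)
suff [w3 e3] : exists w3, positive_word w = positive_word [:: l, k & w3].
  exists [:: k, l & w3].
  by rewrite !positive_word_cons e3 !positive_word_cons !mulgA braid_kl.
have dlw : descent w l.
  move: d dk; rewrite /descent word_perm_cons !permM.
  have [h|h] : l = k.+1 :> nat \/ k = l.+1 :> nat by lia.
    have e : lower l = upper k by exact: val_inj.
    by rewrite e swap_upper swap_id /=; lia.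
  have e : upper l = lower k by exact: val_inj.
  by rewrite e swap_lower (@swap_id _ k (lower l)) /=; lia.
have [w' e] := ih w l hs rw dlw.
have rlw' := reduced_eq e rw; have [rw' _] := reduced_cons rlw'.
have sw' : size w' < s.
  by have := size_positive_word e; rewrite /=; lia.
have dkw' : descent w' k.
  have pw : word_perm w = swap l * word_perm w'.
    by rewrite -word_perm_cons /word_perm e.
  move: d; rewrite /descent word_perm_cons pw !permM.
  have [h|h] : l = k.+1 :> nat \/ k = l.+1 :> nat by lia.
    have e1 : lower l = upper k by exact: val_inj.
    rewrite (@swap_id _ k (upper l)) ?swap_upper /=; try lia.
    by rewrite e1 swap_upper (@swap_id _ l (lower k)) /= -?e1; lia.
  have e1 : upper l = lower k by exact: val_inj.
  rewrite (@swap_id _ k (lower l)) ?swap_lower /=; try lia.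
  by rewrite e1 swap_lower (@swap_id _ l (upper k)) /= -?e1; lia.
have [w3 e3] := ih w' k sw' rw' dkw'; exists w3.
by rewrite e !(positive_word_cons l) e3.
Qed.

(** Descents depend only on the permutation, so the first letter of [v] is a descent of [u];
    exchange brings it to the front of [u], where it cancels. *)
Lemma reduced_word_perm_inj u v :
  reduced u -> reduced v -> word_perm u = word_perm v ->
  positive_word u = positive_word v.
Proof.
elim: v u => [|l v ih] [|k u] // ru rv e.
- by have := descent_cons ru; rewrite /descent e word_perm_nil !perm1 /=; lia.
- by have := descent_cons rv; rewrite /descent -e word_perm_nil !perm1 /=; lia.
have dl : descent (k :: u) l by rewrite /descent e; apply: descent_cons.
have [u' eu] := exchange ru dl.
rewrite eu !positive_word_cons (ih u') //.
- by have [] := reduced_cons (reduced_eq eu ru).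
- by have [] := reduced_cons rv.
apply: (mulgI (swap l)); rewrite -!word_perm_cons -e.
by rewrite /word_perm eu.
Qed.

(** * Half twists: complements, reversal, conjugation, length *)

Definition full w := forall i j, i != j -> crossings w i j = 1%N.

Lemma full_reduced w : full w -> reduced w.
Proof. by move=> h i j ij; rewrite h. Qed.

(** A further letter [l] crosses two strings that have not met before. They must therefore cross in
    the complement, which has a descent at [l] and by exchange can be made to start with [l]. *)
Lemma full_complement d w : full d -> reduced w ->
  exists w', positive_word d = positive_word (w ++ w').
Proof.
move=> fd; elim/last_ind: w => [|w l ih] rw; first by exists d.
have rw' : reduced w.
  by move=> i j ij; have := rw i j ij; rewrite -cats1 crossings_word_cat; lia.
have [w' e] := ih rw'.
have rww' : reduced w'.
  move=> i j ij; set p := word_perm w.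
  have := crossings_positive_word (p^-1 i) (p^-1 j) e.
  by rewrite crossings_word_cat -/p !permKV fd ?(inj_eq perm_inj) //; lia.
have dl : descent w' l.
  set p := word_perm w; set a := p^-1 (lower l); set b := p^-1 (upper l).
  have ab : a != b by rewrite (inj_eq perm_inj) lower_neq_upper.
  have := rw a b ab; rewrite -cats1 crossings_word_cat /= -/p !permKV eqxx.
  have := crossings_positive_word a b e.
  rewrite crossings_word_cat fd // -/p !permKV.
  rewrite (crossings_reduced rww') ?lower_neq_upper // /descent /=.
  have : word_perm w' (lower l) != word_perm w' (upper l).
    by rewrite (inj_eq perm_inj) lower_neq_upper.
  by rewrite -val_eqE /=; move: (crossings w a b) => c; case: ltnP; case: ltnP; lia.
have [w2 e2] := exchange rww' dl; exists w2.
rewrite e !positive_word_cat e2 positive_word_cons positive_word_rcons.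
by rewrite mulgA.
Qed.

(** All pairs cross, so the permutation is strictly decreasing. *)
Lemma full_word_perm w i : full w -> word_perm w i = rev_ord i.
Proof.
move=> fw.
have dec (a b : 'I_n) : a < b -> word_perm w b < word_perm w a.
  move=> ab; have nab : a != b by rewrite -val_eqE /=; lia.
  have := fw a b nab; rewrite (crossings_reduced (full_reduced fw)) //.
  have : word_perm w a != word_perm w b by rewrite (inj_eq perm_inj).
  by rewrite -val_eqE ab /=; lia.
(* Over a distance [d] the value drops by at least [d]; comparing [i] with both end positions then
   fixes its image. *)
have gap d (a b : 'I_n) : b = (a + d)%N :> nat -> word_perm w b + d <= word_perm w a.
  elim: d b => [|d ih] b h; first by rewrite addn0; have -> : b = a by apply: val_inj => /=; lia.
  have hb : a + d < n by have := ltn_ord b; lia.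
  have := ih (Ordinal hb) erefl; have := @dec (Ordinal hb) b.
  by rewrite /= h; lia.
have n0 : 0 < n by have := ltn_ord i; lia.
have nn : n.-1 < n by lia.
have := gap i (Ordinal n0) i (erefl _); have := gap (n.-1 - i)%N i (Ordinal nn).
have := ltn_ord (word_perm w (Ordinal n0)); have := ltn_ord i.
by move=> h1 h2 h3 h4; apply: val_inj; move: h3 h4 => /=; lia.
Qed.

(** Write [Delta] as [l :: w]. Then [rcons w (rev_ord l)] is also full, hence equals [Delta] too,
    and [sigma l * Delta = Delta * sigma (rev_ord l)]. *)
Lemma half_twist_conj Delta l : half_twist Delta ->
  sigma l ^ Delta = sigma (rev_ord l).
Proof.
case=> d -> fd; have rd : reduced d by exact: full_reduced.
have dl : descent d l.
  rewrite /descent !full_word_perm //=; have := ltn_ord l; lia.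
have [w e] := exchange rd dl.
have pw : word_perm w = swap l * word_perm d.
  by rewrite [in RHS]/word_perm e -/(word_perm _) word_perm_cons mulgA tperm2 mul1g.
(* The last letter here crosses the pair that the first letter of [l :: w] crosses, up to
   relabelling by [swap l]. *)
have fw : full (rcons w (rev_ord l)).
  move=> i j ij; rewrite -cats1 crossings_word_cat /= addn0.
  have := crossings_positive_word (swap l i) (swap l j) e.
  rewrite fd ?(inj_eq perm_inj) //= !tpermK addnC => h.
  rewrite [RHS]h; congr (_ + nat_of_bool _)%N.
  rewrite !crossE !pw !permM !full_word_perm //=.
  move: (swap l i) (swap l j) => a b.
  by have := ltn_ord l; have := ltn_ord a; have := ltn_ord b; lia.
have e2 : positive_word (rcons w (rev_ord l)) = positive_word d.
  apply: reduced_word_perm_inj; [exact: full_reduced|by []|].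
  by apply/permP => i; rewrite !full_word_perm.
move: e2; rewrite positive_word_rcons => e2.
apply: (mulgI (positive_word d)); rewrite -conjgC -{1}e2 e positive_word_cons.
by rewrite mulgA.
Qed.

(** Double counting over ordered pairs: every letter contributes 2. *)
Lemma size_full w : full w -> size w = (n * n.-1)./2.
Proof.
move=> fw.
have sum_cross u : (\sum_i \sum_(j | j != i) crossings u i j)%N = (size u).*2.
  elim: u => [|k u ih]; first by rewrite big1 // => i _; rewrite big1.
  rewrite /= doubleS -ih -addn2 addnC.
  under eq_bigr do rewrite big_split.
  rewrite big_split /=; congr (_ + _)%N.
    rewrite (bigD1 (lower k)) //= (bigD1 (upper k)) /=; last first.
      by rewrite eq_sym lower_neq_upper.
    rewrite eqxx big1; last first.
      by move=> j; rewrite crossE -!val_eqE /=; lia.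
    rewrite (bigD1 (upper k)) /=; last by rewrite eq_sym lower_neq_upper.
    rewrite (bigD1 (lower k)) /=; last exact: lower_neq_upper.
    rewrite setUC eqxx big1; last first.
      by move=> j; rewrite crossE -!val_eqE /=; lia.
    rewrite big1 // => i /andP [i1 i2]; rewrite big1 // => j _; rewrite crossE.
    by move: i1 i2; rewrite -!val_eqE /=; lia.
  rewrite [RHS](reindex_inj (@perm_inj _ (swap k))) /=.
  apply: eq_bigr => i _; rewrite [RHS](reindex_inj (@perm_inj _ (swap k))) /=.
  by apply: eq_bigl => j; rewrite (inj_eq perm_inj).
have := sum_cross w.
under eq_bigr => i _.
  rewrite (eq_bigr (fun=> 1%N)); last by move=> j ji; rewrite fw // eq_sym.
  rewrite sum1_card cardC1 card_ord.
  over.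
by rewrite sum_nat_const card_ord => ->; rewrite doubleK.
Qed.

(** * Letter classes and connectedness of the closure *)

(* The letters l and rev_ord l, exchanged by conjugation by a half twist, form
   one class, labelled by its smaller index. *)
Definition letter_class l := minn l (n.-2 - l).

Lemma letter_class_rev l : letter_class (rev_ord l) = letter_class l.
Proof. by rewrite /letter_class /=; have := ltn_ord l; lia. Qed.

Lemma knot_letter_class Delta beta v m :
  half_twist Delta -> beta * positive_word v = Delta -> closure_is_knot beta ->
  m < n.-1./2 -> m \in map letter_class v.
Proof.
case=> d -> fd e knot hm; apply/negPn/negP => hv.
(* The outermost [m.+1] positions on either side; only letters of class [m] cross the boundary of
   [A]. *)
pose A := [pred p : 'I_n | (p <= m) || (n.-1 - m <= p)].
have A_rev p : (rev_ord p \in A) = (p \in A).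
  by rewrite !inE /=; have := ltn_ord p; lia.
have A_word p : (word_perm v p \in A) = (p \in A).
  elim: v {e} hv p => [|l v ih] hv p; first by rewrite word_perm_nil perm1.
  move: hv; rewrite /= inE negb_or => /andP [hl hv].
  rewrite word_perm_cons permM ih // !inE; move: hl; rewrite /letter_class.
  by have := swapP l p; have := ltn_ord l; have := ltn_ord p; lia.
have A_end p : (string_end beta p \in A) = (p \in A).
  rewrite -A_word -permM /word_perm -string_endM e -/(word_perm d).
  by rewrite full_word_perm.
have glued_sym : connect_sym (glued beta).
  by apply: sym_connect_sym => p q; rewrite /glued orbC.
have clA : closed (glued beta) A.
  by move=> p q /orP [] /eqP ->; rewrite A_end.
have n0 : 0 < n by lia.
have m1 : m.+1 < n by lia.
(* [x] lies in [A] and [y] does not, because [m < n.-1./2]. *)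
pose x := Ordinal n0; pose y := Ordinal m1.
have : connect (glued beta) x y.
  rewrite -(root_connect glued_sym); apply/eqP.
  have /eqP := knot; rewrite /closure_components /n_comp_mem => /eqP c1.
  by apply: (card_le1_eqP (eq_leq c1)); rewrite !inE roots_root.
by move/(closed_connect clA); rewrite !inE /=; lia.
Qed.

(** * Commutation and the descending product *)

Lemma commute_positive_word x v :
  {in v, forall l, commute (sigma l) x} -> commute (positive_word v) x.
Proof.
move=> h; apply: commute_sym; rewrite /positive_word big_seq.
by apply: commute_prod => l lv; apply/commute_sym/h.
Qed.

(* sigma_m ... sigma_1 in the numbering of the paper. *)
Definition descending m : braid n := (\prod_(i < n.-1 | i < m) (sigma i)^-1)^-1.

Lemma descending0 : descending 0 = 1.
Proof. by rewrite /descending big_pred0_eq invg1. Qed.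

Lemma descendingS m (hm : m < n.-1) :
  descending m.+1 = sigma (Ordinal hm) * descending m.
Proof.
(* Extending the factors by 1 to all of [nat] turns the filtered product into one over ['I_s], whose
   last factor splits off. *)
pose F (i : nat) : braid n :=
  if (insub i : option 'I_n.-1) is Some l then (sigma l)^-1 else 1.
have E s : s <= n.-1 ->
    \prod_(i < n.-1 | i < s) (sigma i)^-1 = \prod_(i < s) F i.
  move=> hs; rewrite (big_ord_widen n.-1 F hs).
  by apply: eq_bigr => i _; rewrite /F valK.
rewrite /descending !E //; last exact: ltnW.
by rewrite big_ord_recr /= invMg /F insubT invgK.
Qed.

Lemma commute_descending l m : {in [pred a : 'I_n.-1 | a < m],
  forall a, commute (sigma l) (sigma a)} -> commute (sigma l) (descending m).
Proof.
move=> h; apply: commuteV; apply: commute_prod => i hi.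
exact/commuteV/h.
Qed.

(** * Conjugacy of braids through their complements in the half twist *)

Lemma braid_conjugate_refl (x : braid n) : braid_conjugate x x.
Proof. by exists 1; rewrite conjg1. Qed.

Lemma braid_conjugate_sym (x y : braid n) :
  braid_conjugate x y -> braid_conjugate y x.
Proof. by case=> g ->; exists g^-1; rewrite conjgK. Qed.

Lemma braid_conjugate_trans (x y z : braid n) :
  braid_conjugate x y -> braid_conjugate y z -> braid_conjugate x z.
Proof. by case=> g -> [h ->]; exists (g * h); rewrite conjgM. Qed.

Section TwistedConjugacy.
Variable Delta : braid n.
Hypothesis hDelta : half_twist Delta.

Definition twisted_conj x y := braid_conjugate (Delta * x^-1) (Delta * y^-1).

(** Conjugate by [x]; carrying the resulting [x^-1] across [Delta] turns it into the inverse of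
    [x ^ Delta]. *)
Lemma twisted_conj_rot x y : twisted_conj (x * y) (y * x ^ Delta).
Proof.
exists x; rewrite /conjg !invMg !invgK !mulgA mulgKV.
by rewrite mulgV mul1g.
Qed.

Lemma positive_word_conj v :
  positive_word v ^ Delta = positive_word (map (@rev_ord _) v).
Proof.
elim: v => [|l v ih]; first by rewrite /positive_word !big_nil conj1g.
by rewrite /= !positive_word_cons conjMg ih half_twist_conj.
Qed.

(** Rotating the mirrored word behind [y] mirrors it back to [v], which then commutes with [y]. *)
Lemma twisted_conj_flip v y : commute (positive_word v) y ->
  twisted_conj (positive_word v * y) (positive_word (map (@rev_ord _) v) * y).
Proof.
move=> ->; apply: braid_conjugate_sym.
have := twisted_conj_rot (positive_word (map (@rev_ord _) v)) y.
by rewrite positive_word_conj (mapK (@rev_ordK _)).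
Qed.

(* The letters of class m are moved next to the part already sorted; one on the
   wrong side is mirrored together with all letters of higher class, which is
   possible because all of these then commute with the sorted part. *)
Lemma twisted_conj_sort m s v : m + s <= n.-1./2 ->
  perm_eq (map letter_class v) (iota m s) ->
  twisted_conj (positive_word v * descending m) (descending (m + s)).
Proof.
elim: s m v => [|s ih] m v hs pv.
  move/perm_nilP: pv; case: v => //= _.
  by rewrite /positive_word big_nil mul1g addn0; apply: braid_conjugate_refl.
have hm : m < n.-1 by lia.
have above c : m < letter_class c -> commute (sigma c) (descending m).
  move=> hc; apply: commute_descending => i; rewrite inE => hi.
  by apply: commute_far; move: hc; rewrite /letter_class; lia.
(* The mirror image has index [n.-2 - m > m], at distance at least 2 from all indices below [m]. *)
have level c : letter_class c = m ->
    c = Ordinal hm \/ c = rev_ord (Ordinal hm) /\ commute (sigma c) (descending m).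
  move=> hc; have [->|] := eqVneq c (Ordinal hm); first by left.
  rewrite -val_eqE /= => ncm; right; split.
    by apply: val_inj => /=; move: hc (ltn_ord c); rewrite /letter_class; lia.
  apply: commute_descending => i; rewrite inE => hi.
  by apply: commute_far; move: hc; rewrite /letter_class; lia.
have apart c a : letter_class c = m -> m.+1 < letter_class a ->
    commute (sigma a) (sigma c).
  move=> hc ha; apply: commute_far; move: hc ha; rewrite /letter_class.
  by have := ltn_ord c; have := ltn_ord a; lia.
have rev_class u :
    map letter_class (map (@rev_ord _) u) = map letter_class u.
  by rewrite -map_comp; apply: eq_map => l; apply: letter_class_rev.
have gt_class u : perm_eq (map letter_class u) (iota m.+1 s) ->
    {in u, forall a, m < letter_class a}.
  move=> pu a /(map_f letter_class); rewrite (perm_mem pu) mem_iota.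
  by case/andP.
have last u c : perm_eq (map letter_class u) (iota m.+1 s) ->
    letter_class c = m ->
    twisted_conj (positive_word (rcons u c) * descending m)
      (descending (m + s.+1)).
  move=> pu hc; rewrite addnS -addSn.
  have top u' : perm_eq (map letter_class u') (iota m.+1 s) ->
      twisted_conj (positive_word (rcons u' (Ordinal hm)) * descending m)
        (descending (m.+1 + s)).
    move=> pu'; rewrite positive_word_rcons.
    by rewrite -mulgA -descendingS; apply: ih => //; lia.
  have [->|[ec cc]] := level c hc; first exact: top.
  apply: braid_conjugate_trans (top (map (@rev_ord _) u) _).
    rewrite -[Ordinal hm]rev_ordK -ec -map_rcons; apply: twisted_conj_flip.
    apply: commute_positive_word => a; rewrite mem_rcons inE.
    by case/predU1P=> [->//|/(gt_class _ pu)/above].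
  by rewrite rev_class.
(* Rotation sends the front letter to the end, mirrored; it commutes with [descending m], so [last]
   applies. *)
have first u c : perm_eq (map letter_class u) (iota m.+1 s) ->
    letter_class c = m ->
    twisted_conj (positive_word (c :: u) * descending m)
      (descending (m + s.+1)).
  have top u' : perm_eq (map letter_class u') (iota m.+1 s) ->
      twisted_conj (positive_word (Ordinal hm :: u') * descending m)
        (descending (m + s.+1)).
    move=> pu'; rewrite positive_word_cons -mulgA.
    apply: braid_conjugate_trans (twisted_conj_rot _ _) _.
    have hr : letter_class (rev_ord (Ordinal hm)) = m.
      by rewrite /letter_class /=; lia.
    rewrite half_twist_conj // -mulgA.
    have [e|[_ <-]] := level _ hr.
      by move/(congr1 val): e => /=; lia.
    have := last u' _ pu' hr.
    by rewrite positive_word_rcons mulgA.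
  move=> pu hc; have [->|[ec cc]] := level c hc; first exact: top.
  apply: braid_conjugate_trans (top (map (@rev_ord _) u) _).
    rewrite -[Ordinal hm]rev_ordK -ec -map_cons; apply: twisted_conj_flip.
    apply: commute_positive_word => a; rewrite inE.
    by case/predU1P=> [->//|/(gt_class _ pu)/above].
  by rewrite rev_class.
have /mapP [c cv hc] : m \in map letter_class v.
  by rewrite (perm_mem pv) mem_iota; lia.
case/splitPr: cv pv => u w pv.
have puw : perm_eq (map letter_class (u ++ w)) (iota m.+1 s).
  by move: pv; rewrite map_cat /= -hc perm_catC /= perm_cons perm_catC map_cat.
(* Only a letter of class [m.+1] can block [c], and there is at most one: if it is in [w], then [c]
   moves to the front, otherwise to the end. *)
have [mw|mw] := boolP (m.+1 \in map letter_class w).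
  have cu : commute (positive_word u) (sigma c).
    apply: commute_positive_word => a au; apply: apart => //.
    have := gt_class _ puw a; rewrite mem_cat au => /(_ isT).
    rewrite leq_eqVlt => /predU1P [e|//].
    have := iota_uniq m.+1 s; rewrite -(perm_uniq puw) map_cat cat_uniq.
    case/and3P=> _ /hasPn/(_ _ mw) /=; rewrite e map_f //.
  have := first (u ++ w) c puw (esym hc).
  by rewrite !(positive_word_cons, positive_word_cat) !mulgA cu.
have cw : commute (positive_word w) (sigma c).
  apply: commute_positive_word => a aw; apply: apart => //.
  have := gt_class _ puw a; rewrite mem_cat aw orbT => /(_ isT).
  rewrite leq_eqVlt => /predU1P [e|//].
  by move: mw; rewrite e map_f.
have := last (u ++ w) c puw (esym hc).
rewrite positive_word_rcons !(positive_word_cat, positive_word_cons) -!mulgA.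
by rewrite (mulgA (positive_word w)) cw -!mulgA.
Qed.

End TwistedConjugacy.
End PositivePermutationBraids.

Theorem theorem5 (n : nat) (hn : (1 <= n)%N) (Delta beta : braid n)
  (hDelta : half_twist Delta)
  (hperm : positive_permutation_braid beta)
  (hcross : has_crossing_number beta ((n * n.-1)./2 - n.-1./2)%N)
  (hknot : closure_is_knot beta) :
  braid_conjugate beta
    (Delta * \prod_(i < n.-1 | (i < n.-1./2)%N) (sigma i)^-1).
Proof.
case: (hperm) => w ew rw; case: (hDelta) => d ed fd.
have [v edv] := full_complement fd rw.
have ebv : beta * positive_word v = Delta by rewrite ew ed edv positive_word_cat.
have sv : size v = n.-1./2.
  case: hcross => w2 e2 sw2.
  have sw : size w = size w2 by apply: size_positive_word; rewrite -ew.
  have := size_positive_word edv; rewrite size_cat (size_full fd) sw sw2.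
  (* This rules out truncation in the subtraction of [hcross]. *)
  have : (n.-1./2 <= (n * n.-1)./2)%N by rewrite half_leq // leq_pmull.
  by lia.
have pv : perm_eq (map (@letter_class n) v) (iota 0 n.-1./2).
  have sub : {subset iota 0 n.-1./2 <= map (@letter_class n) v}.
    move=> m; rewrite mem_iota => /= hm.
    exact: knot_letter_class hDelta ebv hknot hm.
  have le : size (map (@letter_class n) v) <= size (iota 0 n.-1./2).
    by rewrite size_map size_iota sv.
  have [_ eqi] := uniq_min_size (iota_uniq _ _) sub le.
  rewrite perm_sym uniq_perm ?iota_uniq //.
  by rewrite (leq_size_uniq (iota_uniq 0 n.-1./2) sub le).
have := @twisted_conj_sort n Delta hDelta 0 n.-1./2 v (leqnn _) pv.
rewrite /twisted_conj descending0 mulg1 -{1}ebv mulgK.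
by rewrite /descending invgK.
Qed.
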